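(* For any Cantor minimal system $(X,\varphi)$ there is a unique (up to conjugacy) odometer $(Y,\psi)$ with the following properties: (1) $(Y,\psi)$ is a factor of $(X,\varphi)$; (2) every odometer which is a factor of $(X,\varphi)$ is also a factor of $(Y,\psi)$. Moreover, there is a factor map $\alpha:(X,\varphi)\to(Y,\psi)$ such that, if $\beta:(X,\varphi)\to(Z,\eta)$ is a factor map onto an odometer $(Z,\eta)$, then there is a (necessarily unique) factor map $\gamma:(Y,\psi)\to(Z,\eta)$ such that $\beta=\gamma\circ\alpha$.
   Context: A Cantor minimal system $(X,\varphi)$ is a minimal homeomorphism $\varphi$ of a space $X$ homeomorphic to the Cantor set. A factor map $(X,\varphi)\to(Y,\psi)$ is a continuous surjection $\alpha:X\to Y$ with $\alpha\circ\varphi=\psi\circ\alpha$; $(Y,\psi)$ is then a factor of $(X,\varphi)$. A conjugacy is a factor map that is a homeomorphism. For a sequence $(k_n)_{n\ge1}$ of positive integers, an odometer of type $(k_n)_{n\ge1}$ is the minimal system $(X,\varphi)$ with $X=\prod_{n=1}^\infty\{0,1,\ldots,k_n-1\}$ and $\varphi$ the addition of $(1,0,0,\ldots)$ with carrying (to the right). Trivial odometers, with $X$ finite (i.e. $k_n=1$ for all but finitely many $n$), are included. *)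

(* Defs.v *)
From mathcomp Require Import all_boot.
From mathcomp Require Import all_classical.
From mathcomp Require Import topology cantor.

Set Implicit Arguments.
Unset Strict Implicit.
Unset Printing Implicit Defensive.

Local Open Scope classical_set_scope.

Definition homeomorphism (X Y : topologicalType) (f : X -> Y) : Prop :=
  continuous f /\
  exists g : Y -> X, [/\ cancel f g, cancel g f & continuous g].

Definition minimal_homeomorphism (X : topologicalType) (phi : X -> X) : Prop :=
  homeomorphism phi /\
  forall E : set X, closed E -> phi @` E = E -> E = set0 \/ E = [set: X].

Definition cantor_minimal (X : topologicalType) (phi : X -> X) : Prop :=
  (exists h : X -> cantor_space, homeomorphism h) /\
  minimal_homeomorphism phi.

Definition factor_map (X Y : topologicalType) (phi : X -> X) (psi : Y -> Y)
    (alpha : X -> Y) : Prop :=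
  [/\ continuous alpha, set_surj [set: X] [set: Y] alpha
    & alpha \o phi = psi \o alpha].

(* [factor_of phi psi]: the system psi is a factor of the system phi. *)
Definition factor_of (X Y : topologicalType) (phi : X -> X) (psi : Y -> Y)
    : Prop :=
  exists alpha : X -> Y, factor_map phi psi alpha.

Definition conjugate (X Y : topologicalType) (phi : X -> X) (psi : Y -> Y)
    : Prop :=
  exists alpha : X -> Y, factor_map phi psi alpha /\ homeomorphism alpha.

(* Sequences of positive integers are indexed from 0 rather than from 1. *)
Definition positive_seq (k : nat -> nat) : Prop := forall n, 0 < k n.

Definition odometer_space (k : nat -> nat) : topologicalType :=
  prod_topology (fun n => discrete_topology 'I_(k n)).

(* The carry into position n. Adding (1, 0, 0, ...) amounts to feeding the
   carry 1 into position 0; this also makes sense when k 0 = 1, in which case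
   1 is not itself a digit. *)
Fixpoint odometer_carry (k : nat -> nat) (x : odometer_space k) (n : nat)
    : nat :=
  if n is m.+1 then (x m + odometer_carry x m) %/ k m else 1.

Lemma odometer_digit_subproof (k : nat -> nat) (x : odometer_space k)
    (n : nat) : (x n + odometer_carry x n) %% k n < k n.
Proof. by rewrite ltn_mod (leq_ltn_trans (leq0n (x n)) (ltn_ord (x n))). Qed.

Definition odometer (k : nat -> nat) (x : odometer_space k)
    : odometer_space k :=
  fun n => Ordinal (odometer_digit_subproof x n).

(* The odometer of type k satisfies properties (1) and (2) relative to phi. *)
Definition maximal_odometer_factor (X : topologicalType) (phi : X -> X)
    (k : nat -> nat) : Prop :=
  factor_of phi (@odometer k) /\
  forall l : nat -> nat, positive_seq l ->
    factor_of phi (@odometer l) -> factor_of (@odometer k) (@odometer l).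

(* Main.v *)
Require Import Defs.
From mathcomp Require Import all_boot.
From mathcomp Require Import all_classical.
From mathcomp Require Import topology cantor.

(* Call m a period of (X, phi) if some locally constant f : X -> nat satisfies
   f (phi x) = f x + 1 mod m. By minimality f is determined mod m by its value
   at a base point, so the functions normalized to vanish there are compatible
   under divisibility, and the periods are closed under lcm. The maximal odometer
   is the inverse limit of Z/K_n along a chain K_n of lcms of all periods.
   Reducing the digits of an odometer factor of type l modulo l_0 ... l_(n-1)
   gives a period of X, which therefore divides some K_N, and this yields the
   map from the maximal odometer. *)

Set Implicit Arguments.
Unset Strict Implicit.
Unset Printing Implicit Defensive.

Local Open Scope classical_set_scope.

(** * Locally constant functions and continuity *)

Definition locally_constant (X : topologicalType) (T : Type) (f : X -> T) :=
  forall x, \forall y \near x, f y = f x.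

Lemma locally_constant_comp (X : topologicalType) (S T : Type) (g : S -> T)
    (f : X -> S) : locally_constant f -> locally_constant (g \o f).
Proof. by move=> fc x; apply: filterS (fc x) => y /= ->. Qed.

Lemma locally_constant_pair (X : topologicalType) (S T : Type) (f : X -> S)
    (g : X -> T) :
  locally_constant f -> locally_constant g ->
  locally_constant (fun x => (f x, g x)).
Proof.
move=> fc gc x; near=> y; congr pair; near: y; [exact: fc|exact: gc].
Unshelve. all: by end_near. 
Qed.

Lemma locally_constant_cst (X : topologicalType) (T : Type) (t : T) :
  locally_constant (fun _ : X => t).
Proof. by move=> x; exact: nearW. Qed.

Lemma locally_constant_precomp (X Y : topologicalType) (T : Type) (h : X -> Y)
    (f : Y -> T) :
  continuous h -> locally_constant f -> locally_constant (f \o h).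
Proof. by move=> hc fc x; exact: hc (fc (h x)). Qed.

Lemma locally_constant_closed (X : topologicalType) (T : Type) (f : X -> T)
    (A : set T) : locally_constant f -> closed (f @^-1` A).
Proof.
move=> fc; rewrite -[_ @^-1` _]setCK closedC openE => x nAx.
by apply: filterS (fc x) => y /= ->.
Qed.

Lemma locally_constant_discreteP (X : topologicalType) (T : choiceType)
    (f : X -> discrete_topology T) :
  continuous f <-> locally_constant f.
Proof.
split=> [fc x|fc x]; first exact: fc (discrete_set1 _).
by apply/discrete_cvg; exact: fc.
Qed.

Lemma continuous_prodP (X : topologicalType) (I : Type)
    (K : I -> topologicalType) (f : X -> prod_topology K) :
  continuous f <-> forall i, continuous (fun x => f x i).
Proof.
split=> [fc i x|fc x].
  have /cvg_sup/(_ i) fci := fc x.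
  have pc := @initial_continuous _ _ (fun g : prod_topology K => g i) (f x).
  by move=> A /pc /fci.
apply/cvg_sup => i A [_ [[B oB <-] Bfx] BA].
by apply: filterS BA _; apply: (fc i x B); exact: open_nbhs_nbhs.
Qed.

(** * Mixed-radix arithmetic in odometers *)

Definition radix (k : nat -> nat) (n : nat) : nat := \prod_(i < n) k i.

(** The projection of the odometer onto its finite quotient Z/[radix k n], as a least
    representative. *)
Definition residue (k : nat -> nat) (x : odometer_space k) (n : nat) : nat :=
  \sum_(i < n) x i * radix k i.

Lemma radixS k n : radix k n.+1 = radix k n * k n.
Proof. by rewrite /radix big_ord_recr. Qed.

Lemma radix_gt0 k n : positive_seq k -> 0 < radix k n.
Proof. by move=> k0; apply: prodn_gt0. Qed.

Lemma radix_dvd k m n : m <= n -> radix k m %| radix k n.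
Proof.
move=> /subnK <-; elim: (n - m) => // d /dvdn_trans; apply.
by rewrite addSn radixS dvdn_mulr.
Qed.

Lemma residueS k (x : odometer_space k) n :
  residue x n.+1 = x n * radix k n + residue x n.
Proof. by rewrite /residue big_ord_recr addnC. Qed.

Lemma residue_lt k (x : odometer_space k) n :
  positive_seq k -> residue x n < radix k n.
Proof.
move=> k0; elim: n => [|n IH]; first by rewrite /residue /radix !big_ord0.
rewrite residueS radixS (@leq_trans ((x n).+1 * radix k n)) //.
  by rewrite mulSn addnC ltn_add2r.
by rewrite mulnC leq_mul2l ltn_ord orbT.
Qed.

Lemma residue_mod k (x : odometer_space k) m n :
  m <= n -> residue x n = residue x m %[mod radix k m].
Proof.
move=> /subnK <-; elim: (n - m) => // d IH.
rewrite addSn residueS -modnDml.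
have /eqP -> : radix k m %| x (d + m) * radix k (d + m).
  by rewrite dvdn_mull // radix_dvd ?leq_addl.
exact: IH.
Qed.

Lemma residue_inj k (x y : odometer_space k) :
  positive_seq k -> (forall n, residue x n = residue y n) -> x = y.
Proof.
move=> k0 xy; apply: functional_extensionality_dep => n; apply/val_inj => /=.
have := xy n.+1; rewrite !residueS xy => /addIn/eqP.
by rewrite eqn_pmul2r ?radix_gt0 // => /eqP.
Qed.

Lemma modn_mul_digit a K m :
  a %% (K * m) = (a %/ K) %% m * K + a %% K.
Proof.
case: K => [|K]; first by rewrite mul0n muln0 !modn0.
case: m => [|m]; first by rewrite muln0 !modn0 -divn_eq.
rewrite {1}(divn_eq a K.+1) {1}(divn_eq (a %/ K.+1) m.+1) mulnDl -mulnA.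
rewrite [m.+1 * _]mulnC -addnA modnMDl modn_small //.
rewrite (@leq_trans ((a %/ K.+1 %% m.+1).+1 * K.+1)) //.
  by rewrite mulSn addnC ltn_add2r ltn_mod.
by rewrite mulnC leq_mul2l /= ltn_mod.
Qed.

(** The carry is the overflow when 1 is added to the number formed by the first n digits; the
    successive quotients of the recursion merge into one. *)
Lemma odometer_carryE k (x : odometer_space k) n :
  positive_seq k -> odometer_carry x n = (residue x n + 1) %/ radix k n.
Proof.
move=> k0; elim: n => [|n IH]; first by rewrite /residue /radix !big_ord0.
rewrite /= IH radixS divnMA residueS -addnA divnMDl //.
exact: radix_gt0.
Qed.

(** On each finite quotient the odometer is addition of 1; carries do not appear after this
    point. *)
Lemma residue_odometer k (x : odometer_space k) n :
  positive_seq k -> residue (odometer x) n = (residue x n + 1) %% radix k n.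
Proof.
move=> k0; elim: n => [|n IH]; first by rewrite /residue /radix !big_ord0.
rewrite residueS /= IH odometer_carryE // residueS -addnA radixS modn_mul_digit.
by rewrite divnMDl ?radix_gt0 // modnMDl.
Qed.

Lemma locally_constant_residue k n :
  locally_constant (fun x : odometer_space k => residue x n).
Proof.
elim: n => [|n IH].
  have := @locally_constant_cst (odometer_space k) _ 0.
  by congr locally_constant; apply: funext => x; rewrite /residue big_ord0.
have dc : locally_constant (fun x : odometer_space k => x n).
  by apply/locally_constant_discreteP; apply: (continuous_prodP id).1 => x A.
have := locally_constant_comp (fun p => p.1 * radix k n + p.2)
  (locally_constant_pair (locally_constant_comp (@nat_of_ord _) dc) IH).
by congr locally_constant; apply: funext => x; rewrite residueS.
Qed.

(** Inverse to [residue] on compatible sequences. Digit n is read off [a n.+1], the first term that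
    is meaningful modulo [radix k n.+1]. *)
Definition digits (k : nat -> nat) (k0 : positive_seq k) (a : nat -> nat)
    : odometer_space k :=
  fun n => Ordinal (ltn_pmod (a n.+1 %/ radix k n) (k0 n)).

Lemma residue_digits k (k0 : positive_seq k) (a : nat -> nat) n :
  (forall n, a n.+1 = a n %[mod radix k n]) ->
  residue (digits k0 a) n = a n %% radix k n.
Proof.
move=> coh; elim: n => [|n IH].
  by rewrite /residue /radix !big_ord0 modn1.
by rewrite residueS /= IH -coh radixS -modn_mul_digit.
Qed.

(** * Eigenfunctions and maps to odometers *)

(** For m > 0 this is a lift to [nat] of a map to Z/m; exp(2 pi i f/m) is then an eigenfunction in
    the usual sense, with eigenvalue exp(2 pi i/m). *)
Definition eigenfunction (X : topologicalType) (phi : X -> X) (m : nat)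
    (f : X -> nat) : Prop :=
  locally_constant f /\ forall x, f (phi x) = f x + 1 %[mod m].

Definition period (X : topologicalType) (phi : X -> X) (m : nat) : Prop :=
  0 < m /\ exists f, eigenfunction phi m f.

Lemma eigenfunction_dvd (X : topologicalType) (phi : X -> X) d m f :
  d %| m -> eigenfunction phi m f -> eigenfunction phi d f.
Proof.
move=> dm [fc fE]; split=> // x.
by rewrite -(modn_dvdm (f (phi x)) dm) fE modn_dvdm.
Qed.

Lemma eigenfunction_residue (X : topologicalType) (phi : X -> X) k
    (beta : X -> odometer_space k) n :
  positive_seq k -> continuous beta -> beta \o phi = @odometer k \o beta ->
  eigenfunction phi (radix k n) (fun x => residue (beta x) n).
Proof.
move=> k0 bc be; split.
  exact: (locally_constant_precomp bc (@locally_constant_residue k n)).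
by move=> x; rewrite (congr1 (@^~ x) be : beta _ = _) residue_odometer // modn_mod.
Qed.

(** Converse to [eigenfunction_residue]. Digit n depends only on [a n.+1], which gives continuity;
    equivariance is checked on residues, which separate points. *)
Lemma digits_equivariant (X : topologicalType) (phi : X -> X) k
    (k0 : positive_seq k) (a : nat -> X -> nat) :
  (forall n, eigenfunction phi (radix k n) (a n)) ->
  (forall n x, a n.+1 x = a n x %[mod radix k n]) ->
  let al := fun x => digits k0 (fun n => a n x) in
  continuous al /\ al \o phi = @odometer k \o al.
Proof.
move=> ea coh al; split.
  apply/continuous_prodP => n; apply/locally_constant_discreteP.
  have [ac _] := ea n.+1; move=> x.
  by apply: filterS (ac x) => y axy; apply/val_inj; rewrite /= axy.
apply: funext => x; apply: (residue_inj k0) => n.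
rewrite /= residue_odometer // !residue_digits ?modnDml //.
by have [_ ->] := ea n.
Qed.

Lemma eigenfunction_iter (X : topologicalType) (phi : X -> X) m f j x :
  eigenfunction phi m f -> f (iter j phi x) = f x + j %[mod m].
Proof.
move=> [_ fE]; elim: j => [|j IH]; first by rewrite addn0.
by rewrite iterS fE -modnDml IH modnDml -addnA addn1.
Qed.

(* The cylinders around a point of the odometer pull back to nested nonempty
   clopen sets, so compactness provides a preimage. *)
Lemma odometer_map_surj (X : topologicalType) (phi : X -> X) (x0 : X) k
    (beta : X -> odometer_space k) :
  compact [set: X] -> positive_seq k -> continuous beta ->
  beta \o phi = @odometer k \o beta -> set_surj [set: X] [set: _] beta.
Proof.
move=> cX k0 bc be y _.
have eb n := eigenfunction_residue n k0 bc be.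
pose A n := [set x | residue (beta x) n = residue y n].
have A0 n : A n !=set0.
  pose c := residue (beta x0) n.
  (* These steps take the residue from [c] to [radix k n], that is to 0, and then on to
     [residue y n]. *)
  exists (iter (residue y n + (radix k n - c)) phi x0).
  rewrite /A /= -(modn_small (residue_lt (beta _) n k0)).
  rewrite (eigenfunction_iter _ _ (eb n)) addnCA.
  rewrite subnKC ?(ltnW (residue_lt _ _ _)) //.
  by rewrite modnDr modn_small ?residue_lt.
have Adec m n : m <= n -> A n `<=` A m.
  move=> mn x /= Anx; rewrite /A /=.
  rewrite -(modn_small (residue_lt (beta x) m k0)) -(residue_mod _ mn) Anx.
  by rewrite (residue_mod _ mn) modn_small ?residue_lt.
pose F := filter_from [set: nat] A.
have FF : ProperFilter F.
  apply: filter_from_proper => //; apply: filter_from_filter; first by exists 0.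
  move=> i j _ _; exists (maxn i j) => // x Ax.
  by split; apply: Adec Ax; rewrite ?leq_maxl ?leq_maxr.
have [|p [_ Fp]] := cX F FF; first by exists 0.
exists p => //; apply: (residue_inj k0) => n.
have FA : F (A n) by exists n.
(* Some neighbourhood of [p] on which the residue is constant meets [A n]. *)
by have [z [Az /= <-]] := Fp _ _ FA ((eb n).1 p).
Qed.

Lemma eigenfunction_add (X : topologicalType) (phi : X -> X) m f c :
  eigenfunction phi m f -> eigenfunction phi m (fun x => f x + c).
Proof.
move=> [fc fE]; split; first exact: (locally_constant_comp (addn^~ c)).
by move=> x; rewrite -modnDml fE modnDml addnAC.
Qed.

(** * Rigidity under minimality, and the periods *)

Section minimal.
Variables (X : topologicalType) (phi : X -> X) (x0 : X).
Hypothesis phi_min : minimal_homeomorphism phi.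

(** The backward implication puts the preimage of a point of [A] in [A], so that [A] equals its
    image and minimality applies. *)
Lemma minimal_closed_invariant (A : set X) :
  closed A -> A x0 -> (forall x, A (phi x) <-> A x) -> forall x, A x.
Proof.
have [[_ [g [phiK gK _]]] minA] := phi_min => cA Ax0 iA.
have im : phi @` A = A.
  apply/seteqP; split=> [_ [x Ax <-]|x Ax]; first exact/iA.
  by exists (g x); rewrite ?gK //; apply/iA; rewrite gK.
by have [A0|->//] := minA A cA im; rewrite A0 in Ax0.
Qed.

(** Both functions grow by 1 along [phi], so the closed set where they agree modulo m is invariant
    in both directions. *)
Lemma eigenfunction_unique m f g :
  eigenfunction phi m f -> eigenfunction phi m g ->
  f x0 = g x0 %[mod m] -> forall x, f x = g x %[mod m].
Proof.
move=> [fc fE] [gc gE] fg0.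
apply: minimal_closed_invariant => //.
  apply: (@locally_constant_closed _ _ (fun x => (f x, g x))
           [set p | p.1 = p.2 %[mod m]]).
  exact: locally_constant_pair.
move=> x; rewrite fE gE; split=> [/eqP|/eqP] fgx; apply/eqP.
  by rewrite eqn_modDr in fgx.
by rewrite eqn_modDr.
Qed.

(** In [nat], [f x0 * m.-1] stands for the negative of [f x0] modulo m; [period_normalized] uses the
    same device. *)
Lemma eigenfunction_shift m f g :
  0 < m -> eigenfunction phi m f -> eigenfunction phi m g ->
  forall x, g x = f x + (f x0 * m.-1 + g x0) %[mod m].
Proof.
move=> m0 ef eg; apply: eigenfunction_unique => //.
  exact: eigenfunction_add.
by rewrite addnA -mulnS prednK // -modnDml modnMl.
Qed.

Lemma period_normalized m :
  period phi m -> exists f, eigenfunction phi m f /\ f x0 = 0 %[mod m].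
Proof.
case=> m0 [f ef]; exists (fun x => f x + f x0 * m.-1); split.
  exact: eigenfunction_add.
by rewrite -mulnS prednK // modnMl mod0n.
Qed.

Lemma period1 : period phi 1.
Proof.
split=> //; exists (fun=> 0); split; first exact: locally_constant_cst.
by move=> x; rewrite !modn1.
Qed.

(* The pairs (f x, g x) solvable by a simultaneous congruence form a clopen
   invariant condition that holds at x0, so no Chinese remainder theorem is
   needed. *)
Lemma period_lcm m n : period phi m -> period phi n -> period phi (lcmn m n).
Proof.
move=> pm pn.
have [f [ef f0]] := period_normalized pm.
have [g [eg g0]] := period_normalized pn.
split; first by rewrite lcmn_gt0 pm.1 pn.1.
pose C (p : nat * nat) := [set j | j = p.1 %[mod m] /\ j = p.2 %[mod n]].
have fgc := locally_constant_pair ef.1 eg.1.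
have Cfg : forall x, C (f x, g x) !=set0.
  apply: minimal_closed_invariant.
  - exact: (@locally_constant_closed _ _ _ [set p | C p !=set0]).
  - by exists 0; split.
  move=> x; split=> [[j [/= jf jg]]|[j [/= jf jg]]].
    (* One step back: [(m * n).-1] is -1 modulo both m and n. *)
    exists (j + (m * n).-1).
    have mn0 : 0 < m * n by rewrite muln_gt0 pm.1 pn.1.
    split; apply/eqP; rewrite -(eqn_modDr 1) -addnA addn1 prednK //=.
      by rewrite -ef.2 -jf [m * n]mulnC addnC modnMDl.
    by rewrite -eg.2 -jg addnC modnMDl.
  by exists (j + 1); split; rewrite /= ?ef.2 ?eg.2 -modnDml ?jf ?jg modnDml.
(* The choice depends on x only through [(f x, g x)], which keeps it locally constant. By [Cfg] the
   default 0 never replaces a solution, and solutions are unique modulo the lcm. *)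
exists (fun x => xget 0 (C (f x, g x))); split.
  exact: (locally_constant_comp (fun p => xget 0 (C p))).
move=> x; have := xgetPex 0 (Cfg x); have := xgetPex 0 (Cfg (phi x)).
set i := xget _ _; set j := xget _ _; move=> [/= im iN] [/= jm jn].
have ijm : i = j + 1 %[mod m] by rewrite im ef.2 -[RHS]modnDml jm modnDml.
have ijn : i = j + 1 %[mod n] by rewrite iN eg.2 -[RHS]modnDml jn modnDml.
apply/eqP; have [ij|/ltnW ij] := leqP (j + 1) i; last rewrite eq_sym.
  by rewrite eqn_mod_dvd // dvdn_lcm -!eqn_mod_dvd // ijm ijn !eqxx.
by rewrite eqn_mod_dvd // dvdn_lcm -!eqn_mod_dvd // ijm ijn !eqxx.
Qed.

(** * The maximal odometer factor and its universal property *)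

Definition normalized m : X -> nat :=
  xget (fun=> 0) [set f | eigenfunction phi m f /\ f x0 = 0 %[mod m]].

Lemma normalizedP m : period phi m ->
  eigenfunction phi m (normalized m) /\ normalized m x0 = 0 %[mod m].
Proof.
move=> pm; rewrite /normalized; case: xgetP => [f _ //|nf].
by have [f /nf] := period_normalized pm.
Qed.

(** The lcm of all periods below n. With finitely many periods the chain stabilizes and the
    resulting odometer is finite. *)
Fixpoint period_chain n : nat :=
  if n is m.+1 then
    lcmn (period_chain m) (if `[< period phi m >] then m else 1)
  else 1.

Lemma period_chainP n : period phi (period_chain n).
Proof.
elim: n => [|n IH] /=; first exact: period1.
by apply: period_lcm => //; case: asboolP => // _; exact: period1.
Qed.

Lemma period_chain_dvd n : period_chain n %| period_chain n.+1.
Proof. exact: dvdn_lcml. Qed.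

Lemma dvd_period_chain m : period phi m -> m %| period_chain m.+1.
Proof. by move=> pm /=; rewrite (asboolT pm) dvdn_lcmr. Qed.

(** Ratios of consecutive terms, so that [radix] telescopes back to the chain. *)
Definition max_type n : nat := period_chain n.+1 %/ period_chain n.

Lemma max_type_gt0 : positive_seq max_type.
Proof.
move=> n; rewrite divn_gt0 ?(period_chainP _).1 //.
by rewrite dvdn_leq ?period_chain_dvd ?(period_chainP _).1.
Qed.

Lemma radix_max_type n : radix max_type n = period_chain n.
Proof.
elim: n => [|n IH]; first by rewrite /radix big_ord0.
by rewrite radixS IH mulnC divnK ?period_chain_dvd.
Qed.

Definition max_factor (x : X) : odometer_space max_type :=
  digits max_type_gt0 (fun n => normalized (period_chain n) x).

Lemma normalized_chain n x :
  normalized (period_chain n.+1) x = normalized (period_chain n) x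
    %[mod period_chain n].
Proof.
have [e1 z1] := normalizedP (period_chainP n.+1).
have [e0 z0] := normalizedP (period_chainP n).
have dv := period_chain_dvd n.
apply: eigenfunction_unique => //; first exact: eigenfunction_dvd e1.
by rewrite z0 -(modn_dvdm _ dv) z1 modn_dvdm.
Qed.

Lemma residue_max_factor x n :
  residue (max_factor x) n = normalized (period_chain n) x %[mod radix max_type n].
Proof.
rewrite residue_digits ?modn_mod // => {}n.
by rewrite radix_max_type normalized_chain.
Qed.

Hypothesis X_compact : compact [set: X].

Lemma max_factorP : factor_map phi (@odometer max_type) max_factor.
Proof.
have [||c e] := @digits_equivariant X phi _ max_type_gt0
    (fun n => normalized (period_chain n)).
- by move=> n; rewrite radix_max_type; have [] := normalizedP (period_chainP n).
- by move=> n x; rewrite radix_max_type normalized_chain.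
split=> //.
exact: (odometer_map_surj x0 X_compact max_type_gt0 c e).
Qed.

(** By rigidity, the residues of [beta] modulo [L n] differ from those of [max_factor] by a
    constant. As [max_factor] vanishes at [x0], [gamma] is reduction followed by translation by
    [beta x0]. *)
Lemma max_factor_universal l (beta : X -> odometer_space l) :
  positive_seq l -> factor_map phi (@odometer l) beta ->
  exists gamma : odometer_space max_type -> odometer_space l,
    factor_map (@odometer max_type) (@odometer l) gamma /\
    beta = gamma \o max_factor.
Proof.
move=> l0 [bc bs be].
(* By [dvd_period_chain], the period [L n] divides the term of the chain at index [(L n).+1]. *)
pose L := radix l; pose N n := (L n).+1.
have eb n := eigenfunction_residue n l0 bc be.
have pL n : period phi (L n).
  by split; [exact: radix_gt0|exists (fun x => residue (beta x) n)].
have LN n : L n %| radix max_type (N n).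
  by rewrite radix_max_type; exact: dvd_period_chain (pL n).
pose a n (y : odometer_space max_type) := residue y (N n) + residue (beta x0) n.
have a_coh n y : a n.+1 y = a n y %[mod L n].
  rewrite /a -modnDm [in RHS]/= -[RHS]modnDm; congr ((_ + _) %% _).
    have le : N n <= N n.+1 by rewrite ltnS dvdn_leq ?radix_gt0 ?radix_dvd.
    by rewrite -(modn_dvdm _ (LN n)) (residue_mod y le) modn_dvdm.
  exact: residue_mod.
(* With the identity as factor map, the residues of the odometer are eigenfunctions of the odometer
   itself. *)
have idE : id \o @odometer max_type = @odometer max_type \o id by [].
have ey n := eigenfunction_dvd (LN n)
  (eigenfunction_residue (N n) max_type_gt0 (fun x => @cvg_id _ _) idE).
have ea n : eigenfunction (@odometer max_type) (L n) (a n).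
  exact: eigenfunction_add (ey n).
have [gc ge] := digits_equivariant l0 ea a_coh.
set gamma := (fun y => _) in gc ge.
have [mc ms me] := max_factorP.
have bE : beta = gamma \o max_factor.
  apply: funext => x; apply: (residue_inj l0) => n.
  rewrite /= residue_digits // -(modn_small (residue_lt _ n l0)).
  have em := eigenfunction_dvd (LN n)
    (eigenfunction_residue (N n) max_type_gt0 mc me).
  apply: (eigenfunction_unique (eb n) (eigenfunction_add _ em)).
  have [_ z] := normalizedP (period_chainP (N n)).
  rewrite -[RHS]modnDml -(modn_dvdm (residue (max_factor x0) _) (LN n)).
  by rewrite residue_max_factor radix_max_type z !mod0n.
exists gamma; split=> //; split=> //.
move=> z _; have [x _ <-] := bs z I.
by exists (max_factor x) => //; rewrite bE.
Qed.

(* Composing the factor maps in both directions gives an endomorphism of the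
   maximal odometer, hence a translation, which can be undone on residues. *)
Lemma max_factor_conjugate k' :
  positive_seq k' -> factor_of phi (@odometer k') ->
  factor_of (@odometer k') (@odometer max_type) ->
  conjugate (@odometer max_type) (@odometer k').
Proof.
move=> k'0 [beta bf] [delta [dc ds de]].
have [gamma [gf bE]] := max_factor_universal k'0 bf.
have [gc gs ge] := gf.
have [mc ms me] := max_factorP.
pose K := radix max_type; have K0 n : 0 < K n by exact: radix_gt0 max_type_gt0.
have ed n := eigenfunction_residue n max_type_gt0 dc de.
have em n := eigenfunction_residue n max_type_gt0 mc me.
pose d x := delta (gamma (max_factor x)).
have edx n : eigenfunction phi (K n) (fun x => residue (d x) n).
  have [c e] := ed n; split.
    apply: (locally_constant_precomp (h := gamma \o max_factor)) c.
    by rewrite -bE; case: bf.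
  move=> x; rewrite /d -e (congr1 (@^~ x) me : max_factor _ = _) /=.
  by rewrite (congr1 (@^~ (max_factor x)) ge : gamma _ = _).
(* The translation from [d] back to [max_factor], as provided by [eigenfunction_shift]. *)
pose c n := residue (d x0) n * (K n).-1 + residue (max_factor x0) n.
have shift n x : residue (max_factor x) n = residue (d x) n + c n %[mod K n].
  exact: (eigenfunction_shift (K0 n) (edx n) (em n)).
pose a n z := residue (delta z) n + c n.
have a_coh n z : a n.+1 z = a n z %[mod K n].
  (* Compatibility of [c] is not checked directly: each z is [gamma (max_factor x)], where [a j] is
     the residue of [max_factor x]. *)
  have [y _ <-] := gs z I; have [x _ <-] := ms y I.
  have dv : K n %| K n.+1 by exact: radix_dvd.
  have aE j : a j (gamma (max_factor x)) = residue (max_factor x) j %[mod K j].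
    by rewrite shift.
  by rewrite -(modn_dvdm _ dv) aE modn_dvdm // residue_mod // aE.
have ea n : eigenfunction (@odometer k') (K n) (a n).
  exact: eigenfunction_add (ed n).
have [hc _] := digits_equivariant max_type_gt0 ea a_coh.
set h := (fun y => _) in hc.
have gK : cancel gamma h.
  move=> y; have [x _ <-] := ms y I.
  apply: (residue_inj max_type_gt0) => n.
  rewrite residue_digits // -[RHS](modn_small (residue_lt _ n max_type_gt0)).
  by rewrite -shift.
exists gamma; split=> //; split=> //; exists h; split=> //.
by move=> z; have [y _ <-] := gs z I; rewrite gK.
Qed.

End minimal.

Theorem theorem4p12 (X : topologicalType) (phi : X -> X) :
  cantor_minimal phi ->
  exists k : nat -> nat,
    [/\ positive_seq k,
        maximal_odometer_factor phi k,
        (forall k' : nat -> nat, positive_seq k' ->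
           maximal_odometer_factor phi k' ->
           conjugate (@odometer k) (@odometer k'))
      & exists alpha : X -> odometer_space k,
          factor_map phi (@odometer k) alpha /\
          forall (l : nat -> nat) (beta : X -> odometer_space l),
            positive_seq l ->
            factor_map phi (@odometer l) beta ->
            exists! gamma : odometer_space k -> odometer_space l,
              factor_map (@odometer k) (@odometer l) gamma /\
              beta = gamma \o alpha].
Proof.
move=> [[h [_ [g [hK gK gc]]]] phi_min].
(* The base point comes from the Cantor space, and so does compactness. *)
pose x0 := g point.
have cX : compact [set: X].
  have -> : [set: X] = g @` [set: cantor_space].
    by apply/seteqP; split=> // x _; exists (h x) => //; exact: hK.
  apply: continuous_compact cantor_space_compact.
  exact: continuous_subspaceT.
have mf := max_factorP x0 phi_min cX.
have k0 := @max_type_gt0 _ phi x0 phi_min.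
exists (max_type phi); split=> //.
- split; first by eexists; exact: mf.
  move=> l l0 [beta bf].
  have [gamma [gf _]] := max_factor_universal x0 phi_min cX l0 bf.
  by exists gamma.
- move=> k' k'0 [f1 f2]; apply: max_factor_conjugate => //.
  by apply: f2 => //; eexists; exact: mf.
exists (max_factor x0 phi_min); split=> // l beta l0 bf.
have [gamma [gf bE]] := max_factor_universal x0 phi_min cX l0 bf.
(* Uniqueness: [max_factor] is surjective, so the composite determines [gamma]. *)
exists gamma; split=> // gamma' [_ bE']; apply: funext => y.
have [_ ms _] := mf; have [x _ <-] := ms y I.
exact: (congr1 (@^~ x) (etrans (esym bE) bE')).
Qed.
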